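(* Let $\mathcal{M} = \langle \mathrm{S}, \mathrm{Init}, \mathrm{Act}, \mathbb{A}, \mathbb{P}\rangle$ be a finite Markov decision process, let $\pi:\mathrm{S}\to\mathrm{Act}$ be a policy, let $\mathrm{S_{unsafe}}\subseteq \mathrm{S}$ be a set of unsafe states with associated safety property $\varphi = \square\neg \mathrm{S_{unsafe}}$, and let $\delta$ be a desired safety probability with $\delta \le \mathbb{E}_{s\sim\mathrm{Init}}\big[\mathrm{V}^{\max}_{\mathcal{M},\varphi}(s)\big]$. Then the Shield Design algorithm (described in the context), run on the input $(\mathcal{M},\pi,\varphi,\delta)$, always terminates and outputs an $\epsilon$-shield, i.e. its output is $\mathrm{C}_\epsilon^\ast=\mathrm{C}_\epsilon$ for some $\epsilon\in[0,1]$, such that the modified policy $\pi_\epsilon$ obtained by combining $\pi$ with $\mathrm{C}_\epsilon^\ast$ satisfies the safety property $\varphi$ for the initial state distribution with probability at least $\delta$: $$\mathbb{E}_{s\sim \mathrm{Init}}\big[\mathrm{V}^{\pi_\epsilon}_{\mathcal{M},\varphi}(s)\big]\ \ge\ \delta .$$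
   Context: **MDP.** A Markov decision process (MDP) is a tuple $\langle \mathrm{S}, \mathrm{Init}, \mathrm{Act}, \mathbb{A}, \mathbb{P}\rangle$ where $\mathrm{S}$ is a finite set of states, $\mathrm{Init}$ is a probability distribution on $\mathrm{S}$, $\mathrm{Act}$ is a finite set of actions, $\mathbb{P}:\mathrm{S}\times\mathrm{Act}\times\mathrm{S}\to[0,1]$ is the transition function, written $\mathbb{P}(s'\mid s,a)$, and $\mathbb{A}(s)=\{a\in\mathrm{Act} : \exists s'\in \mathrm{S},\ \mathbb{P}(s'\mid s,a)\neq 0\}$ is the set of actions available in $s$. It is required that $\sum_{s'}\mathbb{P}(s'\mid s,a)=1$ for all $s\in \mathrm{S}$, $a\in\mathbb{A}(s)$, and each $\mathbb{A}(s)$ is nonempty. A policy is a map $\pi:\mathrm{S}\to\mathrm{Act}$. **Safety probabilities.** For $\mathrm{S_{unsafe}}\subseteq\mathrm{S}$, the property $\varphi=\square\neg\mathrm{S_{unsafe}}$ means ''no state in $\mathrm{S_{unsafe}}$ is ever visited (at any time $t\ge 0$, including the starting time)''. For a policy $\pi$ choosing available actions, $\mathrm{V}^{\pi}_{\mathcal{M},\varphi}(s)$ is the probability that the Markov chain on $\mathrm{S}$ started at $s$ with transition probabilities $\mathbb{P}(\cdot\mid s,\pi(s))$ satisfies $\varphi$. $\mathrm{V}^{\max}_{\mathcal{M},\varphi}(s)$ is the maximum of $\mathrm{V}^{\pi}_{\mathcal{M},\varphi}(s)$ over all policies $\pi$ with $\pi(s')\in\mathbb{A}(s')$ for all $s'$.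 For $s\in\mathrm{S}$ and $a\in\mathbb{A}(s)$, $$\mathrm{Q}^{\max}_{\mathcal{M},\varphi}(s,a)=\sum_{s'\in \mathrm{S}}\mathbb{P}(s'\mid s,a)\,\mathrm{V}^{\max}_{\mathcal{M},\varphi}(s').$$ **$\epsilon$-shield.** For $\epsilon\in[0,1]$, the $\epsilon$-shield is the map $\mathrm{C}_\epsilon:\mathrm{S}\to 2^{\mathrm{Act}}$, $$\mathrm{C}_\epsilon(s)=\begin{cases}\{a\in\mathbb{A}(s) : \mathrm{Q}^{\max}_{\mathcal{M},\varphi}(s,a)\ge\epsilon\} & \text{if } \mathrm{V}^{\max}_{\mathcal{M},\varphi}(s)\ge\epsilon,\\ \operatorname{argmax}_{a\in\mathbb{A}(s)}\mathrm{Q}^{\max}_{\mathcal{M},\varphi}(s,a) & \text{if } \mathrm{V}^{\max}_{\mathcal{M},\varphi}(s)<\epsilon,\end{cases}$$ where $\operatorname{argmax}$ denotes the set of maximizers. **Modified policy.** Given $\pi$ and $\mathrm{C}_\epsilon$, the modified policy $\pi_\epsilon:\mathrm{S}\to\mathrm{Act}$ is $\pi_\epsilon(s)=\pi(s)$ if $\pi(s)\in \mathrm{C}_\epsilon(s)$, and otherwise $\pi_\epsilon(s)$ is an element picked from $\mathrm{C}_\epsilon(s)$ (by an arbitrary rule, used by the algorithm and in the conclusion alike). **Shield Design algorithm.** Input: $\mathcal{M},\pi,\varphi,\delta$. A granularity $\eta>0$ is fixed, giving a finite increasing list $0,\eta,2\eta,\dots,1$ of values of $\epsilon$ (which contains $0$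 and $1$). 1. Initialize $\mathrm{C}_\epsilon^\ast(s)=\mathbb{A}(s)$ for all $s\in\mathrm{S}$. 2. Compute $\mathrm{Q}^{\max}_{\mathcal{M},\varphi}(s,a)$ for all state-action pairs. 3. For $\epsilon$ running through $0,\eta,2\eta,\dots,1$ in increasing order: determine $\mathrm{C}_\epsilon$ and the modified policy $\pi_\epsilon$; compute $\mathrm{V}^{\pi_\epsilon}_{\mathcal{M},\varphi}(s)$ for all $s$; if $\mathbb{E}_{s\sim\mathrm{Init}}[\mathrm{V}^{\pi_\epsilon}_{\mathcal{M},\varphi}(s)]\ge\delta$, set $\mathrm{C}_\epsilon^\ast=\mathrm{C}_\epsilon$ and leave the loop. 4. Return $\mathrm{C}_\epsilon^\ast$. All quantities in the algorithm are taken to be computed exactly. *)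

(* Defs.v *)
From HB Require Import structures.
From mathcomp Require Import all_boot all_order all_algebra.
From mathcomp Require Import all_classical all_reals all_analysis.

Set Implicit Arguments.
Unset Strict Implicit.
Unset Printing Implicit Defensive.
Import Order.TTheory GRing.Theory Num.Theory.

Local Open Scope ring_scope.

Definition cylinder (S : finType) (n : nat) (w : nat -> S) : set (nat -> S) :=
  [set omega | forall i, (i <= n)%N -> omega i = w i]%classic.

(* The infinite paths of a chain started at s. Measurable types are pointed and
   S may be empty, hence the parameter s, which only provides the point: a path
   is not required to start at s. *)
Definition paths (S : finType) (s : S) : Type := nat -> S.
HB.instance Definition _ (S : finType) (s : S) := gen_eqMixin (paths s).
HB.instance Definition _ (S : finType) (s : S) := gen_choiceMixin (paths s).
HB.instance Definition _ (S : finType) (s : S) := isPointed.Build (paths s) (fun=> s).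

Definition cylinders (S : finType) (s : S) : set (set (paths s)) :=
  [set A | exists n w, A = cylinder n w]%classic.
Arguments cylinders {S} s _.

Notation path_space s := (g_sigma_algebraType (cylinders s)).

Section MarkovChain.
Context {R : realType} {S : finType}.
Implicit Types (K : S -> S -> R) (s : S).

Definition stochastic K : Prop :=
  (forall x y, 0 <= K x y) /\ (forall x, \sum_y K x y = 1).

Definition is_chain_law K s (mu : probability (path_space s) R) : Prop :=
  forall n (w : nat -> S),
    mu (cylinder n w) = ((w 0 == s)%:R * \prod_(i < n) K (w i) (w i.+1))%:E.

(* The law of the Markov chain with transition matrix K started at s, which
   exists and is unique by chain_lawP and chain_law_unique. The Dirac mass is a
   dummy value for the case that K is not stochastic. *)
Definition chain_law K s : probability (path_space s) R :=
  xget (\d_ (point : path_space s) : probability (path_space s) R)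
       [set mu | is_chain_law K mu]%classic.

End MarkovChain.

(* Existence: the chain is coded on [0, 1) with the uniform distribution, the
   cylinders being sent to subintervals. *)
Section ChainLawExists.
Context {R : realType} {S : finType}.
Variables (K : S -> S -> R) (Kst : stochastic K).
Local Open Scope classical_set_scope.

Let st (k : nat) (x : S) := nth x (enum S) k.
Let F (x : S) (k : nat) : R := \sum_(0 <= j < k) K x (st j x).
Let idx (x : S) (u : R) : nat := find (fun k => u < F x k.+1) (iota 0 #|S|).
Let nxt x u := st (idx x u) x.
Let ren x u := (u - F x (idx x u)) / K x (nxt x u).

Fixpoint chain_code (x : S) (u : R) (n : nat) : S :=
  if n is n'.+1 then chain_code (nxt x u) (ren x u) n' else x.

Let F0 x : F x 0 = 0. Proof. by rewrite /F big_geq. Qed.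

Let FS x k : F x k.+1 = F x k + K x (st k x).
Proof. by rewrite /F big_nat_recr. Qed.

Let F1 x : F x #|S| = 1.
Proof.
rewrite -(Kst.2 x) /F cardE -(big_nth x xpredT (K x)).
by rewrite big_enum.
Qed.

Let F_mono x : {homo F x : i j / (i <= j)%N >-> i <= j}.
Proof. by apply: homo_leq => // [k j i|k]; [exact: le_trans|rewrite FS lerDl Kst.1]. Qed.

Let idxP x u k : (k < #|S|)%N -> 0 <= u < 1 ->
  (idx x u == k) = (F x k <= u < F x k.+1).
Proof.
move=> kS /andP[u0 u1].
have hasu : has (fun k => u < F x k.+1) (iota 0 #|S|).
  apply/hasP; exists #|S|.-1; last by rewrite prednK ?F1// (leq_trans _ kS).
  by rewrite mem_iota /= add0n prednK ?leqnn // (leq_trans _ kS).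
have lt_idx : (idx x u < #|S|)%N by rewrite -[X in (_ < X)%N](size_iota 0) -has_find.
have := nth_find 0%N hasu; rewrite -/(idx x u) nth_iota// add0n => Fidx.
have Fbefore j : (j < idx x u)%N -> F x j.+1 <= u.
  move=> jk; have := before_find 0%N jk.
  by rewrite nth_iota ?(ltn_trans jk)// add0n leNgt => ->.
have Fidx0 : F x (idx x u) <= u.
  by case: (idx x u) Fbefore => [_|j]; [rewrite F0|apply].
apply/eqP/idP => [<-|/andP[Fk Fk1]]; first by rewrite Fidx0.
apply/eqP; rewrite eqn_leq; apply/andP; split; rewrite leqNgt; apply/negP => h.
  by have := Fbefore _ h; rewrite leNgt Fk1.
by have := le_lt_trans Fk (lt_le_trans Fidx (F_mono x h)); rewrite ltxx.
Qed.

Let F_ge0 x k : 0 <= F x k. Proof. by rewrite -(F0 x) F_mono. Qed.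

Let idx_lt x u : 0 <= u < 1 -> (idx x u < #|S|)%N.
Proof.
move=> /andP[_ u1]; have S0 : (0 < #|S|)%N by apply/card_gt0P; exists x.
rewrite -[X in (_ < X)%N](size_iota 0) -has_find.
apply/hasP; exists #|S|.-1; last by rewrite prednK ?F1.
by rewrite mem_iota /= add0n prednK ?leqnn.
Qed.

Let code_cylinder n : forall x (w : nat -> S), w 0%N = x ->
  exists a, [/\ 0 <= a, a + \prod_(i < n) K (w i) (w i.+1) <= 1 &
    forall u, 0 <= u < 1 -> cylinder n w (chain_code x u) <->
      a <= u < a + \prod_(i < n) K (w i) (w i.+1)].
Proof.
elim: n => [|n IH] x w w0.
  exists 0; rewrite big_ord0 add0r; split => // u u01; split => // _ i.
  by rewrite leqn0 => /eqP ->.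
pose y := w 1%N; pose k := index y (enum S).
have kS : (k < #|S|)%N by rewrite cardE index_mem mem_enum.
have stk : st k x = y by rewrite /st nth_index// mem_enum.
have FkS : F x k.+1 = F x k + K x y by rewrite FS stk.
have K0 : 0 <= K x y := Kst.1 x y.
have [a [a0 a1 Ha]] := IH y (fun i => w i.+1) erefl.
have -> : \prod_(i < n.+1) K (w i) (w i.+1) =
    K x y * \prod_(i < n) K (w i.+1) (w i.+2) by rewrite big_ord_recl /= w0.
set p := \prod_(i < n) _ in a1 Ha *.
have Fk1 : F x k + K x y <= 1 by rewrite -FkS -(F1 x) F_mono.
have p0 : 0 <= p by apply: prodr_ge0 => i _; exact: Kst.1.
have Ka : 0 <= K x y * a by rewrite mulr_ge0.
have Kap : K x y * a + K x y * p <= K x y by rewrite -mulrDr ler_piMr.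
exists (F x k + K x y * a); split.
- by rewrite addr_ge0// F_ge0.
- by rewrite -addrA (le_trans _ Fk1)// lerD2l.
move=> u u01.
have cylS : cylinder n.+1 w (chain_code x u) <->
    nxt x u = y /\ cylinder n (fun i => w i.+1) (chain_code (nxt x u) (ren x u)).
  split=> [h|[xy h] [|i] iln].
  - by split=> [|i iln]; [have := h 1%N isT|have := h i.+1 iln].
  - by rewrite w0.
  - exact: h.
have nxtE : nxt x u = y <-> F x k <= u < F x k + K x y.
  rewrite -FkS -idxP//; split=> [|/eqP idxk]; last by rewrite /nxt idxk.
  rewrite /nxt /st /k => <-; rewrite index_uniq ?enum_uniq// -cardE.
  exact: idx_lt.
have ren_eq : nxt x u = y -> ren x u = (u - F x k) / K x y.
  move=> xy; have := xy; rewrite /ren => /nxtE; rewrite -FkS -idxP// => /eqP ->.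
  by rewrite xy.
rewrite cylS; split.
  move=> [xy]; rewrite ren_eq// xy => h.
  have /andP[Fu uF] := nxtE.1 xy.
  have Kgt0 : 0 < K x y by rewrite -(ltrD2l (F x k)) addr0 (le_lt_trans Fu).
  have r01 : 0 <= (u - F x k) / K x y < 1.
    by rewrite divr_ge0 ?subr_ge0//= ltr_pdivrMr// mul1r ltrBlDl.
  move: h; rewrite Ha// ler_pdivlMr// ltr_pdivrMr// => /andP[h1 h2].
  rewrite -addrA -mulrDr -lerBrDl -ltrBlDl.
  by rewrite ![K x y * _]mulrC h1.
move=> /andP[h1 h2].
have xy : nxt x u = y.
  apply/nxtE; rewrite (le_trans _ h1) ?lerDl//=.
  by rewrite (lt_le_trans h2)// -addrA lerD2l.
split=> //; rewrite ren_eq// xy.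
have /andP[Fu uF] := nxtE.1 xy.
have Kgt0 : 0 < K x y by rewrite -(ltrD2l (F x k)) addr0 (le_lt_trans Fu).
rewrite Ha; last first.
  by rewrite divr_ge0 ?subr_ge0//= ltr_pdivrMr// mul1r ltrBlDl.
rewrite ler_pdivlMr// ltr_pdivrMr// ![_ * K x y]mulrC lerBrDl ltrBlDl.
by rewrite mulrDr addrA h1.
Qed.

Let code (x : S) (u : measurableTypeR R) : path_space x :=
  if 0 <= u < 1 then chain_code x u else (fun=> x).

Let preimage_code (x : S) n (w : nat -> S) : exists2 E : set R,
  measurable E & exists2 D : set R, measurable D &
  [/\ D `<=` ~` (`[0, 1[ : set R),
    code x @^-1` cylinder n w = E `|` D, E `<=` (`[0, 1[ : set R) &
    lebesgue_measure E = ((w 0%N == x)%:R * \prod_(i < n) K (w i) (w i.+1))%:E].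
Proof.
have mD : measurable (~` (`[0, 1[ : set R) `&` [set u : R | cylinder n w (fun=> x)]).
  have [c|nc] := pselect (cylinder n w (fun=> x)).
    rewrite (_ : [set u : R | cylinder n w (fun=> x)] = setT); last by apply/seteqP; split => u.
    by rewrite setIT; apply: measurableC.
  by rewrite (_ : [set u : R | cylinder n w (fun=> x)] = set0) ?setI0//; apply/seteqP; split => u.
have codeE (E : set R) : E `<=` (`[0, 1[ : set R) ->
    (forall u, 0 <= u < 1 -> cylinder n w (chain_code x u) <-> E u) ->
    code x @^-1` cylinder n w =
    E `|` (~` (`[0, 1[ : set R) `&` [set u : R | cylinder n w (fun=> x)]).
  move=> E01 HE; apply/seteqP; split=> u; rewrite /= /code in_itv/=.
    by case: ifPn => [u01 /(HE _ u01)|/negP u01]; [left|right].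
  case: ifPn => [u01 [/(HE _ u01)//|[]//]|/negP u01 [|[]//]].
  by move=> /E01; rewrite /= in_itv.
have [w0|w0] := eqVneq (w 0%N) x; last first.
  exists set0 => //; exists (~` (`[0, 1[ : set R) `&` [set u : R | cylinder n w (fun=> x)]) => //.
  split => //; last by rewrite mul0r measure0.
  apply: codeE => // u _; split=> // h.
  by move/eqP: w0; apply; rewrite -(h 0%N).
have [a [a0 a1 Ha]] := code_cylinder n w0; set p := \prod_(i < n) _ in a1 Ha *.
have sub01 : (`[a, a + p[ : set R) `<=` (`[0, 1[ : set R).
  move=> u /=; rewrite !in_itv/= => /andP[au ua].
  by rewrite (le_trans a0 au) (lt_le_trans ua).
exists (`[a, a + p[ : set R) => //.
exists (~` (`[0, 1[ : set R) `&` [set u : R | cylinder n w (fun=> x)]) => //; split => //.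
  by apply: codeE => // u u01; rewrite Ha//= in_itv.
rewrite lebesgue_measure_itv /= lte_fin mul1r ltrDl -EFinB addrAC subrr add0r.
have : 0 <= p by apply: prodr_ge0 => i _; exact: Kst.1.
by rewrite le_eqVlt => /orP[/eqP <-|->//]; rewrite ltxx.
Qed.

Let measurable_code (x : S) : measurable_fun setT (code x : measurableTypeR R -> path_space x).
Proof.
refine (@measurability _ _ _ _ setT (code x) (cylinders x) _ _) => // _ [_ [n [w ->]] <-].
have [E mE [D mD [_ DE _ _]]] := preimage_code x n w.
by rewrite setTI DE; exact: measurableU.
Qed.

HB.instance Definition _ (x : S) :=
  isMeasurableFun.Build _ _ _ _ (code x) (@measurable_code x).

Let uniform_sub (E : set R) : measurable E -> E `<=` (`[0, 1[ : set R) ->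
  uniform_prob (@ltr01 R) E = lebesgue_measure E.
Proof.
move=> mE E01; rewrite /uniform_prob -[RHS]mul1e -integral_cst//.
apply: eq_integral => u /[!inE] /E01 /=; rewrite in_itv/= => /andP[u0 u1].
by rewrite /uniform_pdf u0 (ltW u1) subr0 invr1.
Qed.

Lemma chain_law_exists s :
  exists mu : probability (path_space s) R, is_chain_law K mu.
Proof.
exists (distribution (uniform_prob (@ltr01 R)) (code s)) => n w.
have [E mE [D mD [D01 DE E01 lebE]]] := preimage_code s n w.
rewrite -lebE.
transitivity (uniform_prob (@ltr01 R) (E `|` D)); first by rewrite -DE.
rewrite measureU//; last first.
  by apply/seteqP; split => // u [/E01 ? /D01].
rewrite -uniform_sub//.
pose I : set (measurableTypeR R) := (`[0, 1[ : set R).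
have mI : measurable I by exact: measurable_itv.
have uI : uniform_prob (@ltr01 R) I = 1%E.
  by rewrite uniform_sub// lebesgue_measure_itv/= lte_fin ltr01 -EFinB subr0.
have : (uniform_prob (@ltr01 R) D <= uniform_prob (@ltr01 R) (~` I))%E.
  by apply: le_measure => //; rewrite inE//; apply: measurableC.
rewrite [leRHS](probability_setC _ mI) [X in (1 - X)%E]uI subee//.
rewrite measure_le0 => /eqP ->; exact: adde0.
Qed.

End ChainLawExists.

Section ChainLaw.
Context {R : realType} {S : finType}.

Lemma chain_lawP (K : S -> S -> R) s : stochastic K -> is_chain_law K (chain_law K s).
Proof.
move=> Kst; have [mu mu_law] := chain_law_exists Kst s.
by rewrite /chain_law; case: xgetP => [nu _|/(_ mu)].
Qed.

Lemma chain_law_unique (K : S -> S -> R) s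
    (mu nu : probability (path_space s) R) :
  is_chain_law K mu -> is_chain_law K nu ->
  forall A, measurable A -> mu A = nu A.
Proof.
move=> mu_law nu_law A mA.
pose G := [set A | cylinders s A \/ A = set0 \/ A = setT]%classic.
apply: (@measure_unique _ R (path_space s) G (fun=> setT)) => //.
- apply/seteqP; split.
    apply: smallest_sub; first exact: smallest_sigma_algebra.
    by move=> B cB; apply: sub_sigma_algebra; left.
  apply: smallest_sub; first exact: smallest_sigma_algebra.
  move=> B [cB|[->|->]]; first exact: sub_sigma_algebra.
    exact: (@measurable0 _ (path_space s)).
  exact: (@measurableT _ (path_space s)).
- have GI n m (v w : nat -> S) : (n <= m)%N -> G (cylinder n v `&` cylinder m w)%classic.
    move=> nm; have [vw|vw] := pselect (cylinder n v w).
      left; exists m, w; apply/seteqP; split=> [x []//|x xw]; split=> // i ni.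
      by rewrite xw ?(leq_trans ni)// vw.
    right; left; apply/seteqP; split=> // x [xv xw]; apply: vw => i ni.
    by rewrite -xw ?(leq_trans ni)// xv.
  move=> B C [cB|[->|->]] [cC|[->|->]]; rewrite ?(setI0, set0I, setIT, setTI);
    do ?[by right; left|by right; right|by left].
  move: cB cC => [n [v ->]] [m [w ->]].
  have [nm|/ltnW mn] := leqP n m; first exact: GI.
  by rewrite setIC; exact: GI.
- by move=> _; right; right.
- by apply/seteqP; split=> // x _; exists 0%N.
- move=> B [[n [w ->]]|[->|->]].
  - exact: etrans (mu_law n w) (esym (nu_law n w)).
  - by rewrite !measure0.
  - exact: etrans (probability_setT mu) (esym (probability_setT nu)).
- by move=> _; apply: (le_lt_trans (probability_le1 mu _)) => //; rewrite ltry.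
Qed.

End ChainLaw.

Definition available_in {R : realType} {S Act : finType}
    (P : S -> Act -> S -> R) (s : S) : {set Act} :=
  [set a | [exists s', P s a s' != 0]].

Record mdp (R : realType) (S Act : finType) := MDP {
  init : S -> R;
  trans : S -> Act -> S -> R;  (* trans s a s' is P(s' | s, a) *)
  init_ge0 : forall s, 0 <= init s;
  init_sum1 : \sum_s init s = 1;
  trans_itv : forall s a s', 0 <= trans s a s' <= 1;
  trans_sum1 : forall s a, a \in available_in trans s -> \sum_s' trans s a s' = 1;
  available_neq0 : forall s, available_in trans s != finset.set0
}.

Section Safety.
Context {R : realType} {S Act : finType}.
Variables (M : mdp R S Act) (unsafe : {set S}).

Definition available (s : S) : {set Act} := available_in (trans M) s.

Definition expect_init (f : S -> R) : R := \sum_s init M s * f s.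

Definition safe_paths : set (nat -> S) :=
  [set omega | forall t, omega t \notin unsafe]%classic.

(* Meaningful if pi s' is available for all s', so that the rows sum to 1. *)
Definition value (pi : S -> Act) (s : S) : R :=
  fine (chain_law (fun x y => trans M x (pi x) y) s safe_paths).

(* The maximum of a nonempty finite family of numbers in [0, 1], hence the
   neutral element 0. *)
Definition value_max (s : S) : R :=
  \big[Num.max/0]_(pi : {ffun S -> Act} | [forall s', pi s' \in available s'])
    value pi s.

Definition q_max (s : S) (a : Act) : R := \sum_s' trans M s a s' * value_max s'.

Definition shield (eps : R) (s : S) : {set Act} :=
  if eps <= value_max s then [set a in available s | eps <= q_max s a]
  else [set a in available s | [forall b in available s, q_max s b <= q_max s a]].

End Safety.

Section ShieldDesign.
Context {R : realType} {S Act : finType}.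

(* The policy obtained by combining pi with the shield C, where rule s A is the
   element picked from A in state s. *)
Definition modified (rule : S -> {set Act} -> Act) (pi : S -> Act)
    (C : S -> {set Act}) (s : S) : Act :=
  if pi s \in C s then pi s else rule s (C s).

(* 0, eta, 2 eta, ..., 1: the multiples of eta below 1, followed by 1. *)
Definition grid (eta : R) : seq R :=
  rcons [seq k%:R * eta | k <- iota 0 `|Num.ceil eta^-1|%N] 1.

(* Looping l C: the loop is about to treat the values l, with C as the current
   shield; Returned C: the algorithm has terminated with output C. *)
Inductive config :=
  | Looping of seq R & (S -> {set Act})
  | Returned of (S -> {set Act}).

Variables (M : mdp R S Act) (unsafe : {set S}) (pi : S -> Act) (delta : R)
  (rule : R -> S -> {set Act} -> Act).

Definition shield_design_step (c : config) : config :=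
  match c with
  | Looping (eps :: l) C =>
      let Ceps := shield M unsafe eps in
      if delta <= expect_init M (value M unsafe (modified (rule eps) pi Ceps))
      then Returned Ceps else Looping l C
  | Looping [::] C => Returned C
  | Returned C => Returned C
  end.

Definition shield_design_outputs (eta : R) (C : S -> {set Act}) : Prop :=
  exists n, iter n shield_design_step (Looping (grid eta) (available M)) = Returned C.

End ShieldDesign.

(* Main.v *)
(** The loop stops with a valid shield as soon as some grid value passes the
    test, so it suffices that eps = 1 does.  Every action of the 1-shield
    maximizes Q^max, because Q^max <= 1.  Hence the modified policy for eps = 1
    satisfies V^max(s) <= [s safe] * sum_y P(y | s, pi(s)) V^max(y); iterating
    this inequality n times bounds V^max(s) by the probability of being safe up
    to time n, whose limit is the value of the modified policy. *)
Require Import Defs.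
From mathcomp Require Import all_boot all_order all_algebra.
From mathcomp Require Import all_classical all_reals all_analysis.

Set Implicit Arguments.
Unset Strict Implicit.
Unset Printing Implicit Defensive.
Import Order.TTheory GRing.Theory Num.Theory.
Import numFieldNormedType.Exports.

Local Open Scope ring_scope.

(** * Finite-horizon survival and its limit *)

Section SurvivalProbability.
Context {R : realType} {S : finType}.
Variables (K : S -> S -> R) (unsafe : {set S}).
Hypothesis Kst : stochastic K.
Local Open Scope classical_set_scope.

(** First-step recursion for the probability that the chain from [x] avoids [unsafe] at times 0 to
    [n]. *)
Fixpoint survive (n : nat) (x : S) : R :=
  (x \notin unsafe)%:R * (if n is n'.+1 then \sum_y K x y * survive n' y else 1).

(** The window starts at [k] so that it can be moved past a fixed prefix of the path. *)
Definition safe_during (k n : nat) : set (nat -> S) :=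
  [set omega | forall i, (i <= n)%N -> omega (k + i)%N \notin unsafe].

(** Law of total probability over the state at time [k], which separates the pieces [F y]. *)
Let measure_partition (s : S) (mu : probability (path_space s) R) k
    (A : set (path_space s)) (F : S -> set (path_space s)) (p : S -> R) :
  A = \bigcup_(y in [set: S]) F y ->
  (forall y omega, F y omega -> omega k = y) ->
  (forall y, measurable (F y) /\ mu (F y) = (p y)%:E) ->
  measurable A /\ mu A = (\sum_y p y)%:E.
Proof.
move=> -> Fk mF; split; first by apply: fin_bigcup_measurable => // y _; case: (mF y).
rewrite measure_fin_bigcup; last 3 first.
- exact: finite_finset.
- by move=> x y _ _ [omega [/Fk <- /Fk <-]].
- by move=> y _; case: (mF y).
rewrite (_ : [set: S] = [set` index_enum S]); last first.
  by apply/seteqP; split=> // y _; exact: mem_index_enum.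
rewrite -fsbig_seq ?index_enum_uniq// -sumEFin.
by apply: eq_bigr => y _; case: (mF y).
Qed.

(** Markov property at time [k]. Splitting on the state at time [k.+1] trades one unit of horizon
    for one of prefix, so the induction on [n] needs all [k] and [w]. *)
Lemma law_safe_cylinder s (mu : probability (path_space s) R) n k (w : nat -> S) :
  is_chain_law K mu ->
  let A : set (path_space s) := cylinder k w `&` safe_during k n in
  measurable A /\
  mu A = ((w 0 == s)%:R * \prod_(i < k) K (w i) (w i.+1) * survive n (w k))%:E.
Proof.
move=> mu_law; elim: n k w => [|n IH] k w A; have [wk|wk] := boolP (w k \in unsafe).
- rewrite (_ : A = set0) ?measure0 /= ?wk ?mul0r ?mulr0//.
  by apply/seteqP; split=> // omega [/(_ k (leqnn k)) wE /(_ 0%N isT)]; rewrite addn0 wE wk.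
- rewrite (_ : A = cylinder k w) /= ?wk ?mulr1 ?mul1r ?mulr1.
    by split; [apply: sub_sigma_algebra; exists k, w|exact: mu_law].
  apply/seteqP; split=> [omega []//|omega h]; split=> // i.
  by rewrite leqn0 => /eqP ->; rewrite addn0 h.
- rewrite (_ : A = set0) ?measure0 /= ?wk ?mul0r ?mulr0//.
  by apply/seteqP; split=> // omega [/(_ k (leqnn k)) wE /(_ 0%N isT)]; rewrite addn0 wE wk.
(* The prefix [w] up to time [k], extended by [y] at time [k.+1]. *)
pose v y i := if (i <= k)%N then w i else y.
rewrite /= wk mul1r mulr_sumr.
apply: (measure_partition (k := k.+1)
    (F := fun y => cylinder k.+1 (v y) `&` safe_during k.+1 n)).
- apply/seteqP; split=> [omega [ow os]|omega [y _ [ow os]]].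
    exists (omega k.+1) => //; split=> i; last by rewrite addSnnS => ?; apply: os.
    rewrite /v leq_eqVlt => /predU1P[->|]; first by rewrite ltnn.
    by rewrite ltnS => ik; rewrite ik ow.
  split=> [i ik|[|i] ilt]; first by rewrite ow ?(leqW ik)// /v ik.
    by rewrite addn0 ow// /v leqnn.
  by rewrite -addSnnS os.
- by move=> y omega [/(_ k.+1 (leqnn _)) -> _]; rewrite /v ltnn.
move=> y; have [mB ->] := IH k.+1 (v y); split=> //; congr EFin.
rewrite big_ord_recr /= /v leq0n ltnn leqnn -!mulrA; congr (_ * (_ * _)).
by apply: eq_bigr => i _; rewrite (ltnW (ltn_ord i)) ltn_ord.
Qed.

Lemma law_safe_during s n :
  measurable (safe_during 0 n : set (path_space s)) /\
  chain_law K s (safe_during 0 n) = (survive n s)%:E.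
Proof.
have -> : survive n s = \sum_x (x == s)%:R * survive n x.
  rewrite (bigD1 s)//= eqxx mul1r big1 ?addr0// => x /negPf ->.
  by rewrite mul0r.
apply: (measure_partition (k := 0)
    (F := fun x => cylinder 0 (fun=> x) `&` safe_during 0 n)).
- apply/seteqP; split=> [omega os|omega [x _ []//]].
  by exists (omega 0%N) => //; split=> // i; rewrite leqn0 => /eqP ->.
- by move=> x omega [/(_ 0%N isT) -> _].
move=> x; have := law_safe_cylinder n 0 (fun=> x) (chain_lawP s Kst).
by rewrite big_ord0 mulr1.
Qed.

Let safe_pathsE : safe_paths unsafe = \bigcap_n safe_during 0 n.
Proof.
by apply/seteqP; split=> [omega h n _ i _|omega h t]; [exact: h|exact: (h t)].
Qed.

Lemma measurable_safe_paths s : measurable (safe_paths unsafe : set (path_space s)).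
Proof.
rewrite safe_pathsE; apply: bigcap_measurable => [|n _]; first by exists 0%N.
by case: (law_safe_during s n).
Qed.

(** Continuity from above: [safe_paths] is the decreasing intersection of the events
    [safe_during 0 n]. *)
Lemma survive_cvg s :
  survive ^~ s @ \oo --> fine (chain_law K s (safe_paths unsafe)).
Proof.
have mA n : measurable (safe_during 0 n : set (path_space s)).
  by case: (law_safe_during s n).
have mS := @measurable_safe_paths s.
suff /fine_cvgP[_] : (fun n => (survive n s)%:E) @ \oo -->
    (fine (chain_law K s (safe_paths unsafe)))%:E by [].
rewrite fineK ?fin_num_measure// safe_pathsE.
rewrite safe_pathsE in mS.
rewrite (_ : (fun n => _) = chain_law K s \o safe_during 0); last first.
  by apply/funext => n /=; case: (law_safe_during s n).
apply: nonincreasing_cvg_mu => //.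
  exact: le_lt_trans (probability_le1 _ (mA 0)) (ltry _).
move=> n m nm; rewrite subsetEset => omega h i im; apply: h.
exact: leq_trans nm.
Qed.

(** Pass to the limit in the recursion of [survive]: the shifted sequence has both sides as its
    limit. *)
Lemma law_safe_le s :
  fine (chain_law K s (safe_paths unsafe)) <=
  (s \notin unsafe)%:R * \sum_y K s y * fine (chain_law K y (safe_paths unsafe)).
Proof.
have cvgS : (fun n => survive n.+1 s) @ \oo -->
    (s \notin unsafe)%:R * \sum_y K s y * fine (chain_law K y (safe_paths unsafe)).
  rewrite /=; apply: cvgM; first exact: cvg_cst.
  elim: (index_enum S) => [|y r IHr].
    by under eq_fun do rewrite big_nil; rewrite big_nil; exact: cvg_cst.
  under eq_fun do rewrite big_cons; rewrite big_cons.
  by apply: cvgD => //; apply: cvgM; [exact: cvg_cst|exact: survive_cvg].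
have := @survive_cvg s; rewrite -cvg_shiftS => cvgS'.
by rewrite (cvg_unique _ cvgS' cvgS).
Qed.

(* For safety properties the value is the greatest solution below 1 of the
   Bellman inequality, so greedy policies are optimal. *)
Lemma le_law_safe (f : S -> R) :
  (forall x, f x <= 1) ->
  (forall x, f x <= (x \notin unsafe)%:R * \sum_y K x y * f y) ->
  forall s, f s <= fine (chain_law K s (safe_paths unsafe)).
Proof.
move=> f1 fK s; apply: (cvgr_to_ge (survive_cvg (s := s))).
apply: nearW => n; elim: n s => [|n IH] s; apply: (le_trans (fK s)).
  (* The 1 in [survive 0] becomes the row sum of [K], so that [f y <= 1] applies termwise. *)
  rewrite /= ler_wpM2l// -(Kst.2 s); apply: ler_sum => y _.
  by rewrite ler_piMr// Kst.1.
by rewrite ler_wpM2l//; apply: ler_sum => y _; rewrite ler_wpM2l// Kst.1.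
Qed.

End SurvivalProbability.

(** * Optimality of policies inside the 1-shield *)

Section GreedyPolicy.
Context {R : realType} {S Act : finType}.
Variables (M : mdp R S Act) (unsafe : {set S}).

Let kernel (pi : S -> Act) x y := trans M x (pi x) y.

Let trans_ge0 x a y : 0 <= trans M x a y.
Proof. by case/andP: (trans_itv M x a y). Qed.

Lemma stochastic_policy (pi : S -> Act) :
  (forall s, pi s \in available M s) -> stochastic (kernel pi).
Proof. by move=> piA; split=> x *; [exact: trans_ge0|exact/trans_sum1/piA]. Qed.

Lemma value_le1 (pi : S -> Act) s :
  (forall s, pi s \in available M s) -> value M unsafe pi s <= 1.
Proof.
move=> piA; have Kst := stochastic_policy piA.
have mS : measurable (safe_paths unsafe : set (path_space s)).
  exact: (measurable_safe_paths unsafe Kst).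
by rewrite -lee_fin fineK ?fin_num_measure// probability_le1.
Qed.

Lemma value_max_itv s : 0 <= value_max M unsafe s <= 1.
Proof.
apply/andP; split; first exact: bigmax_ge_id.
by apply: bigmax_le => // pi /forallP; exact: value_le1.
Qed.

Lemma q_max_ge0 s a : 0 <= q_max M unsafe s a.
Proof.
apply: sumr_ge0 => y _; rewrite mulr_ge0 ?trans_ge0//.
by case/andP: (value_max_itv y).
Qed.

Lemma q_max_le1 s a : a \in available M s -> q_max M unsafe s a <= 1.
Proof.
move=> aA; rewrite -(trans_sum1 aA); apply: ler_sum => y _.
by rewrite ler_piMr ?trans_ge0//; case/andP: (value_max_itv y).
Qed.

(** A policy's first action is at most as good as [b], and its value from the next state on is at
    most [value_max]. *)
Lemma value_max_le s b :
  {in available M s, forall a, q_max M unsafe s a <= q_max M unsafe s b} ->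
  value_max M unsafe s <= (s \notin unsafe)%:R * q_max M unsafe s b.
Proof.
(* The neutral element 0 of the maximum must also lie below the bound. *)
move=> bmax; apply: bigmax_le => [|pi piA]; first by rewrite mulr_ge0 ?q_max_ge0.
have /forallP piP := piA.
apply: (le_trans (law_safe_le _ (stochastic_policy piP) s)).
rewrite ler_wpM2l//; apply: (le_trans _ (bmax (pi s) (piP s))).
apply: ler_sum => y _; rewrite ler_wpM2l ?trans_ge0//.
exact: (@le_bigmax_cond _ _ _ _ pi _ (fun p : {ffun S -> Act} => value M unsafe p y)).
Qed.

Lemma available_argmax s : exists2 b, b \in available M s &
  {in available M s, forall a, q_max M unsafe s a <= q_max M unsafe s b}.
Proof.
have /set0Pn[a0 a0A] := available_neq0 M s.
case: (@arg_maxP _ _ _ a0 (mem (available M s)) (q_max M unsafe s) a0A) => b.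
by exists b.
Qed.

(** A maximizer of Q^max lies in both branches: if V^max(s) >= 1, its Q^max is at least V^max(s).
    Hence the picking rule yields an element of the shield. *)
Lemma shield1_neq0 s : shield M unsafe 1 s != finset.set0.
Proof.
have [b bA bmax] := available_argmax s.
apply/set0Pn; exists b; rewrite /shield; case: ifPn => [V1|_]; apply/setIdP; split=> //.
  apply: (le_trans V1); apply: (le_trans (value_max_le bmax)).
  by rewrite ler_piMl ?q_max_ge0// lern1 leq_b1.
exact/forall_inP.
Qed.

(* If V^max(s) = 1, the threshold Q^max >= 1 is attained only by maximizers. *)
Lemma shield1_argmax s b : b \in shield M unsafe 1 s -> b \in available M s /\
  {in available M s, forall a, q_max M unsafe s a <= q_max M unsafe s b}.
Proof.
rewrite /shield; case: ifPn => _ /setIdP[bA].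
  by move=> q1; split=> // a aA; exact: le_trans (q_max_le1 aA) q1.
by move/forall_inP.
Qed.

(** [value_max] itself satisfies the Bellman inequality for the chain of [pi], so [le_law_safe]
    applies to it. *)
Lemma value_max_le_value_shield1 (pi : S -> Act) :
  (forall s, pi s \in shield M unsafe 1 s) ->
  forall s, value_max M unsafe s <= value M unsafe pi s.
Proof.
move=> piC; apply: le_law_safe => [|s|s].
- by apply: stochastic_policy => s; case: (shield1_argmax (piC s)).
- by case/andP: (value_max_itv s).
by apply: value_max_le; case: (shield1_argmax (piC s)).
Qed.

End GreedyPolicy.

(** * The run of the algorithm *)

Lemma modified_in (S Act : finType) (rule : S -> {set Act} -> Act) (pi : S -> Act)
    (C : S -> {set Act}) s :
  (forall A, A != finset.set0 -> rule s A \in A) ->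
  C s != finset.set0 -> modified rule pi C s \in C s.
Proof. by move=> ruleP C0; rewrite /modified; case: ifPn => // _; exact: ruleP. Qed.

Lemma grid_itv (R : realType) (eta eps : R) :
  0 < eta -> eps \in grid eta -> 0 <= eps <= 1.
Proof.
move=> eta0; rewrite mem_rcons inE => /predU1P[->|/mapP[k]].
  by rewrite ler01 lexx.
rewrite mem_iota /= add0n => kc ->; rewrite mulr_ge0 ?ler0n ?(ltW eta0)//=.
rewrite -ler_pdivlMr// mul1r.
(* The absolute value in [grid] is harmless, since the ceiling of a positive number is
   nonnegative. *)
have : (k%:Z < Num.ceil eta^-1)%R.
  by rewrite -[Num.ceil _]gez0_abs// ceil_ge0 (lt_trans _ (_ : 0 < _)) ?invr_gt0// ltrN10.
by rewrite ceil_gt_int => /ltW.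
Qed.

(** The loop stops at the first value passing the test, possibly before the one known to pass. The
    initial [C] would be returned only if none passed. *)
Lemma shield_design_run (R : realType) (S Act : finType) (M : mdp R S Act)
    (unsafe : {set S}) (pi : S -> Act) (delta : R) (rule : R -> S -> {set Act} -> Act)
    (l : seq R) (C : S -> {set Act}) :
  let ok eps := delta <= expect_init M
    (value M unsafe (modified (rule eps) pi (shield M unsafe eps))) in
  has ok l -> exists n eps, [/\ eps \in l, ok eps &
    iter n (shield_design_step M unsafe pi delta rule) (Looping l C) =
    Returned (shield M unsafe eps)].
Proof.
move=> ok; elim: l => //= eps l IH; have [okeps _|nok /= /IH] := boolP (ok eps).
  by exists 1%N, eps; rewrite mem_head /= -/(ok eps) okeps.
move=> [n [e [el oke run]]]; exists n.+1, e; split=> //; first by rewrite inE el orbT.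
by rewrite iterSr /= -/(ok eps) (negPf nok).
Qed.

Theorem theorem1 (R : realType) (S Act : finType) (M : mdp R S Act)
    (pi : S -> Act) (unsafe : {set S}) (delta eta : R)
    (rule : R -> S -> {set Act} -> Act)
    (eta_gt0 : 0 < eta)
    (ruleP : forall eps s (A : {set Act}), A != finset.set0 -> rule eps s A \in A)
    (delta_le : delta <= expect_init M (value_max M unsafe)) :
  exists Cstar : S -> {set Act},
    shield_design_outputs M unsafe pi delta rule eta Cstar /\
    exists eps : R,
      [/\ 0 <= eps <= 1,
          Cstar = shield M unsafe eps &
          delta <= expect_init M
                     (value M unsafe (modified (rule eps) pi Cstar))].
Proof.
have [|n [eps [epsg okeps run]]] :=
  @shield_design_run R S Act M unsafe pi delta rule (grid eta) (available M).
  (* The last grid value 1 passes the test, because its modified policy attains at least [value_max]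
     from every state. *)
  apply/hasP; exists 1; first by rewrite mem_rcons mem_head.
  apply: (le_trans delta_le); apply: ler_sum => s _.
  rewrite ler_wpM2l ?init_ge0//; apply: value_max_le_value_shield1 => x.
  by apply: modified_in; [move=> A; exact: ruleP|exact: shield1_neq0].
exists (shield M unsafe eps); split; first by exists n.
by exists eps; split=> //; exact: grid_itv epsg.
Qed.
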